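(* Let $G$ be a finite connected simple graph. Then the connected subgraph arrangement $\mathcal{A}_G$ (with its defining forms considered over $\mathbb{R}$) is simplicial if and only if $G$ is a triangle (the cycle $C_3$) or a path graph.
   Context: For a finite simple graph $G=(N,E)$ with $N=\{1,\dots,n\}$ and $I\subseteq N$, $G[I]$ denotes the induced subgraph on $I$, and $H_I=\ker\big(\sum_{i\in I}x_i\big)$, where $x_1,\dots,x_n$ are the coordinate functions. The connected subgraph arrangement of $G$ is $\mathcal{A}_G=\{H_I:\emptyset\neq I\subseteq N,\ G[I]\text{ connected}\}$. An arrangement of hyperplanes in $\mathbb{R}^n$ is simplicial if every connected component of the complement of the union of its hyperplanes is an open simplicial cone. *)

(* Defs.v *)
From HB Require Import structures.
From mathcomp Require Import all_boot all_order all_algebra.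
From mathcomp Require Import all_classical all_reals all_analysis.
Set Implicit Arguments. Unset Strict Implicit. Unset Printing Implicit Defensive.
Import Order.TTheory GRing.Theory Num.Theory.
Import numFieldNormedType.Exports.
Local Open Scope classical_set_scope.
Local Open Scope ring_scope.

Definition simple_graph (n : nat) (e : rel 'I_n) : Prop :=
  symmetric e /\ irreflexive e.

Definition induced_connected (n : nat) (e : rel 'I_n) (I : {set 'I_n}) : Prop :=
  I != finset.set0 /\
  forall x y, x \in I -> y \in I ->
    connect [rel u v | [&& e u v, u \in I & v \in I]] x y.

Definition graph_connected (n : nat) (e : rel 'I_n) : Prop :=
  induced_connected e [set: 'I_n].

Definition is_triangle (n : nat) (e : rel 'I_n) : Prop :=
  n = 3%N /\ forall x y, e x y = (x != y).

Definition is_path_graph (n : nat) (e : rel 'I_n) : Prop :=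
  exists f : 'I_n -> 'I_n, bijective f /\
    forall i j : 'I_n, e (f i) (f j) = ((i.+1 == j) || (j.+1 == i))%N.

Definition hyperplane_H (R : realType) (n : nat) (I : {set 'I_n}) : set 'rV[R]_n :=
  [set x | \sum_(i in I) x ord0 i = 0].

Definition csa_complement (R : realType) (n : nat) (e : rel 'I_n) : set 'rV[R]_n :=
  [set x | forall I : {set 'I_n}, induced_connected e I -> ~ @hyperplane_H R n I x].

(* Open simplicial cone in R^n: positive span of n linearly independent
   vectors (the rows of an invertible matrix V). *)
Definition open_simplicial_cone (R : realType) (n : nat) (C : set 'rV[R]_n) : Prop :=
  exists V : 'M[R]_n, V \in unitmx /\
    C = [set x | exists c : 'rV[R]_n, (forall j, 0 < c ord0 j) /\ x = c *m V].

(* An arrangement (given by the complement M of its union) is simplicial if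
   every connected component of M is an open simplicial cone. *)
Definition simplicial_complement (R : realType) (n : nat) (M : set 'rV[R]_n) : Prop :=
  forall x, M x -> open_simplicial_cone (connected_component M x).

(* Main.v *)
(* The chamber of x is determined by the signs at x of the sums over connected sets.
   For a path, prefix sums turn the arrangement into the braid arrangement, and a chamber is
   bounded by the gaps between consecutive sorted prefix sums; for a triangle three bounding
   forms are found in each case. Any other connected graph contains a vertex a with two
   neighbours b, c and a nonempty set K such that {a,b}, {a,c}, {a,b} + K and {a,c} + K are all
   connected (K is a third neighbour of a, or the rest of a cycle). Localizing at a flat turns
   K into one vertex r, and the chamber y_b, y_c, y_r < -y_a < y_b + y_c, y_b + y_r, y_c + y_r
   then has these four sets as facets, although the four forms are linearly dependent. *)
Require Import Defs.
From HB Require Import structures.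
From mathcomp Require Import all_boot all_order all_algebra.
From mathcomp Require Import all_classical all_reals all_analysis.
From mathcomp Require Import zify ring lra.
Set Implicit Arguments. Unset Strict Implicit. Unset Printing Implicit Defensive.
Import Order.TTheory GRing.Theory Num.Theory.
Import numFieldNormedType.Exports.
Local Open Scope ring_scope.

(** * Forms of vertex sets, and chambers as sign regions *)

Definition subset_sum (R : realType) (n : nat) (I : {set 'I_n}) (x : 'rV[R]_n) : R :=
  \sum_(i in I) x ord0 i.

Lemma subset_sumD (R : realType) (n : nat) (I : {set 'I_n}) (x y : 'rV[R]_n) :
  subset_sum I (x + y) = subset_sum I x + subset_sum I y.
Proof. by rewrite /subset_sum -big_split; apply: eq_bigr => i _; rewrite mxE. Qed.

Lemma subset_sumZ (R : realType) (n : nat) (I : {set 'I_n}) (a : R) (x : 'rV[R]_n) :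
  subset_sum I (a *: x) = a * subset_sum I x.
Proof. by rewrite /subset_sum mulr_sumr; apply: eq_bigr => i _; rewrite mxE. Qed.

Lemma subset_sumN (R : realType) (n : nat) (I : {set 'I_n}) (x : 'rV[R]_n) :
  subset_sum I (- x) = - subset_sum I x.
Proof. by rewrite -scaleN1r subset_sumZ mulN1r. Qed.

Lemma subset_sum_continuous (R : realType) (n : nat) (I : {set 'I_n}) :
  continuous (@subset_sum R n I).
Proof.
apply: continuous_big => [x|i _]; first exact: add_continuous.
exact: coord_continuous.
Qed.

(** A positive product says that [x] and [y] lie strictly on the same side of a hyperplane, and it
    stays linear in [y]. *)
Definition chamber (R : realType) (n : nat) (e : rel 'I_n) (x : 'rV[R]_n) : set 'rV[R]_n :=
  [set y | forall I : {set 'I_n}, induced_connected e I ->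
             0 < subset_sum I y * subset_sum I x].

Lemma csa_complementE (R : realType) (n : nat) (e : rel 'I_n) (x : 'rV[R]_n) :
  csa_complement e x <->
  (forall I : {set 'I_n}, induced_connected e I -> subset_sum I x != 0).
Proof. by split=> h I /h /eqP. Qed.

(** The segment from [x] to a point of its chamber meets no hyperplane; conversely each form maps a
    connected part of the complement onto an interval that avoids 0. *)
Lemma connected_component_csa (R : realType) (n : nat) (e : rel 'I_n) (x : 'rV[R]_n) :
  csa_complement e x -> connected_component (csa_complement e) x = chamber e x.
Proof.
move=> /csa_complementE Mx; rewrite eqEsubset; split=> y; last first.
  move=> xy; pose f (t : R) : 'rV[R]_n := x + t *: (y - x).
  have cf : continuous f.
    move=> t; apply: cvgD; first exact: cvg_cst.
    by apply: cvgZ; [exact: cvg_id | exact: cvg_cst].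
  have f0 : f 0 = x by rewrite /f scale0r addr0.
  have f1 : f 1 = y by rewrite /f scale1r addrC subrK.
  apply: (@connected_component_max _ _ (f @` `[0, 1]%classic)).
  - by exists 0 => //; rewrite /= in_itv /= lexx ler01.
  - move=> _ [t /= t01 <-]; apply/csa_complementE => I cI; move: t01.
    rewrite in_itv /= => /andP[t0 t1].
    have := xy _ cI; have := Mx _ cI.
    rewrite /f subset_sumD subset_sumZ subset_sumD subset_sumN.
    set a := subset_sum I x; set b := subset_sum I y => a0 ba.
    suff : 0 < (a + t * (b - a)) * a by move=> h; apply: contraTneq h => ->; rewrite mul0r ltxx.
    have aa : 0 < a * a by rewrite -expr2 exprn_even_gt0.
    have -> : (a + t * (b - a)) * a = (1 - t) * (a * a) + t * (b * a) by ring.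
    have [t_1|t_1] := eqVneq t 1; first by rewrite t_1; lra.
    have : 0 < (1 - t) * (a * a) by rewrite mulr_gt0 // subr_gt0 lt_neqAle t_1.
    have : 0 <= t * (b * a) by rewrite mulr_ge0 // ltW.
    lra.
  - apply: connected_continuous_connected; first exact: segment_connected.
    exact: continuous_subspaceT.
  - by exists 1 => //; rewrite /= in_itv /= lexx ler01.
case=> B [Bx BM cB] By I cI.
have : connected (@subset_sum R n I @` B).
  apply: connected_continuous_connected => //; apply: continuous_subspaceT.
  exact: subset_sum_continuous.
move=> /connected_intervalP itv.
have nz z : B z -> subset_sum I z != 0 by move=> /BM /csa_complementE; apply.
rewrite ltNge; apply/negP => le0.
have no0 : ~ (@subset_sum R n I @` B)%classic 0 by case=> z /nz /eqP.
apply: no0.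
have [x0 y0] := (nz _ Bx, nz _ By).
have [xp|xn] := ltP 0 (subset_sum I x).
  apply: (itv (subset_sum I y) (subset_sum I x)); [by exists y|by exists x|].
  by rewrite (ltW xp) andbT -(pmulr_lle0 _ xp).
have {}xn : subset_sum I x < 0 by rewrite lt_neqAle x0.
apply: (itv (subset_sum I x) (subset_sum I y)); [by exists x|by exists y|].
by rewrite (ltW xn) /= -(nmulr_lle0 _ xn).
Qed.

(** * Chambers bounded by independent forms *)

(** The sets [I k] name the walls of the chamber: [n] independent forms whose signs at [x] decide
    all the others. *)
Definition simplicial_frame (R : realType) (n : nat) (e : rel 'I_n) (x : 'rV[R]_n)
    (I : 'I_n -> {set 'I_n}) : Prop :=
  [/\ forall k, induced_connected e (I k),
      forall y : 'rV[R]_n, (forall k, subset_sum (I k) y = 0) -> y = 0 &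
      forall y : 'rV[R]_n,
        (forall k, 0 < subset_sum (I k) y * subset_sum (I k) x) -> chamber e x y].

Lemma simplicial_frame_cone (R : realType) (n : nat) (e : rel 'I_n) (x : 'rV[R]_n)
    (I : 'I_n -> {set 'I_n}) :
  csa_complement e x -> simplicial_frame e x I -> open_simplicial_cone (chamber e x).
Proof.
move=> /csa_complementE Mx [cI Iinj Isgn].
(* Scaling column [k] by the value of its form at [x] makes the coordinates of [y *m W] the very
   products that define the chamber. The rows of the inverse then generate the cone. *)
pose W : 'M[R]_n := \matrix_(v, k) ((v \in I k)%:R * subset_sum (I k) x).
have WE (y : 'rV[R]_n) k : (y *m W) ord0 k = subset_sum (I k) y * subset_sum (I k) x.
  rewrite mxE /subset_sum mulr_suml [RHS]big_mkcond; apply: eq_bigr => v _.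
  by rewrite mxE; case: ifP; rewrite ?mul1r ?mul0r ?mulr0.
have Wu : W \in unitmx.
  rewrite -row_free_unit; apply: inj_row_free => y y0; apply: Iinj => k.
  apply/eqP; have /eqP := WE y k.
  by rewrite y0 mxE eq_sym mulf_eq0 (negPf (Mx _ (cI k))) orbF.
exists (invmx W); split; first by rewrite unitmx_inv.
rewrite eqEsubset; split=> y.
  move=> yx; exists (y *m W); split; last by rewrite mulmxK.
  by move=> k; rewrite WE; apply: yx.
move=> [c [c0 ->]]; apply: Isgn => k.
by rewrite -WE mulmxKV.
Qed.

(** * Independence of the walls of a simplicial chamber *)

(** The choice [1 / (1 + S)] works because the ratio of the absolute value of [b t] to [a t] is one
    term of [S], hence below [1 + S]. *)
Lemma exists_small_perturbation (R : realType) (T : finType) (P : pred T) (a b : T -> R) :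
  (forall t, P t -> 0 < a t) ->
  exists2 eps : R, 0 < eps & forall t, P t -> 0 < a t + eps * b t.
Proof.
move=> a0; pose S := \sum_(t | P t) `|b t| / a t.
have S0 : 0 <= S by apply: sumr_ge0 => t /a0 at0; rewrite divr_ge0 // ltW.
have S1 : 0 < 1 + S by lra.
exists (1 + S)^-1; first by rewrite invr_gt0.
move=> t Pt; have at0 := a0 _ Pt.
have : `|b t| / a t < 1 + S.
  rewrite /S (bigD1 t) //=.
  have : 0 <= \sum_(i | P i && (i != t)) `|b i| / a i.
    by apply: sumr_ge0 => i /andP[/a0 ai0 _]; rewrite divr_ge0 // ltW.
  lra.
rewrite ltr_pdivrMr // => bt.
rewrite -(pmulr_rgt0 _ S1) mulrDr mulrA divff ?lt0r_neq0 // mul1r.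
by have := ler_norm (- b t); rewrite normrN; lra.
Qed.

(* [p i] lies in the relative interior of the facet of the chamber cut out by [I i];
   in a simplicial cone each such facet form is proportional to its own coordinate,
   so the forms attached to distinct facets are independent. *)
Lemma dependent_walls_not_simplicial (R : realType) (n : nat) (e : rel 'I_n)
    (T : finType) (x : 'rV[R]_n) (p : T -> 'rV[R]_n) (I : T -> {set 'I_n}) (i0 : T) :
  csa_complement e x ->
  (forall i, induced_connected e (I i)) -> injective I ->
  (forall i, subset_sum (I i) (p i) = 0) ->
  (forall i J, induced_connected e J -> J != I i ->
     0 < subset_sum J (p i) * subset_sum J x) ->
  (forall y : 'rV[R]_n, (forall i, i != i0 -> subset_sum (I i) y = 0) ->
     subset_sum (I i0) y = 0) ->
  ~ open_simplicial_cone (chamber e x).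
Proof.
move=> /csa_complementE Mx cI injI p0 ppos dep [V [Vu VE]].
(* [L] gives the coordinates along the generators of the cone, so the chamber is where all of them
   are positive. *)
pose L (y : 'rV[R]_n) : 'rV[R]_n := y *m invmx V.
have LE y : chamber e x y <-> forall j, 0 < L y ord0 j.
  rewrite VE /L; split=> [[c [c0 ->]] j|y0]; first by rewrite mulmxK.
  by exists (y *m invmx V); split=> //; rewrite mulmxKV.
have : forall i, exists j, L (p i) ord0 j <= 0.
  move=> i; apply: contrapT => /forallNP np.
  have /(_ _ (cI i)) : chamber e x (p i).
    by apply/LE => j; rewrite ltNge; apply/negP/np.
  by rewrite p0 mul0r ltxx.
move=> /choice[j jle].
(* [p i + p k] lies in the chamber, as each point is on the side of [x] of the other's wall; a
   shared index would leave that coordinate nonpositive. *)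
have jinj i k : i != k -> j i != j k.
  move=> ik; apply/eqP => jik.
  have : chamber e x (p i + p k).
    move=> J cJ; rewrite subset_sumD mulrDl.
    have [->|Ji] := eqVneq J (I i).
      rewrite p0 mul0r add0r; apply: ppos => //.
      by apply: contraNneq ik => /injI ->.
    have [->|Jk] := eqVneq J (I k).
      by rewrite p0 mul0r addr0; apply: ppos => //; apply: contraNneq ik => /injI ->.
    by rewrite addr_gt0 // ppos.
  move=> /LE /(_ (j i)); rewrite /L mulmxDl mxE.
  by have := jle i; have := jle k; rewrite -jik /L; lra.
(* A small move from [p i] in the direction [y] enters the chamber. Coordinate [j i] is nonpositive
   at [p i], so it must be positive at [y]. *)
have key i y : 0 < subset_sum (I i) y * subset_sum (I i) x -> 0 < L y ord0 (j i).
  move=> y0.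
  have [|eps eps0 epsP] := @exists_small_perturbation R _
      (fun J => `[< induced_connected e J >] && (J != I i))
      (fun J => subset_sum J (p i) * subset_sum J x)
      (fun J => subset_sum J y * subset_sum J x).
    by move=> J /andP[/asboolP cJ Ji]; apply: ppos.
  have : chamber e x (p i + eps *: y).
    move=> J cJ; rewrite subset_sumD subset_sumZ mulrDl -mulrA.
    have [->|Ji] := eqVneq J (I i).
      by rewrite p0 mul0r add0r mulr_gt0.
    by apply: epsP; rewrite Ji andbT; apply/asboolP.
  move=> /LE /(_ (j i)); rewrite /L mulmxDl -scalemxAl mxE [X in _ + X]mxE => h.
  by rewrite -(pmulr_rgt0 _ eps0); have := jle i; rewrite /L; lra.
(* The generator of index [j i0] has all other coordinates zero. By [key] at [v] and [- v], the
   forms with [i != i0] vanish at [v], and by dependence so does the form of [I i0]. *)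
pose v : 'rV[R]_n := delta_mx ord0 (j i0) *m V.
have Lv : L v = delta_mx ord0 (j i0) by rewrite /L mulmxK.
have v0 i : i != i0 -> subset_sum (I i) v = 0.
  move=> ii0; have jj := jinj _ _ ii0.
  apply/eqP; case: (ltgtP 0 (subset_sum (I i) v * subset_sum (I i) x)).
  - by move=> /key; rewrite Lv mxE (negPf jj) andbF ltxx.
  - move=> h; have /key : 0 < subset_sum (I i) (- v) * subset_sum (I i) x.
      by rewrite subset_sumN mulNr oppr_gt0.
    by rewrite /L mulNmx -/(L v) Lv !mxE (negPf jj) andbF oppr0 ltxx.
  - by move=> /eqP; rewrite eq_sym mulf_eq0 (negPf (Mx _ (cI i))) orbF.
have /dep vi0 := v0.
(* Subtracting this multiple of [v] leaves the form of [I i0] unchanged but makes coordinate [j i0]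
   zero, against [key]. *)
have /key : 0 < subset_sum (I i0) (x - L x ord0 (j i0) *: v) * subset_sum (I i0) x.
  rewrite subset_sumD subset_sumN subset_sumZ vi0 mulr0 subr0.
  by rewrite -expr2 exprn_even_gt0 //= Mx.
rewrite {1}/L mulmxBl -scalemxAl -/(L x) -/(L v) Lv !mxE !eqxx mulr1.
by rewrite subrr ltxx.
Qed.

(** * The chamber attached to an obstruction *)

Record obstruction (n : nat) (e : rel 'I_n) (a b c : 'I_n) (K : {set 'I_n}) : Prop :=
  Obstruction {
    obstruction_uniq : uniq [:: a; b; c];
    obstruction_disjoint : [/\ a \notin K, b \notin K & c \notin K];
    obstruction_neq0 : K != finset.set0;
    obstruction_edges : e a b /\ e a c;
    obstruction_connected : induced_connected e ([set a; b] :|: K) /\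
                            induced_connected e ([set a; c] :|: K) }.

(* The terms with factor 16 vanish on a vertex set exactly when it avoids the complement of
   [a, b, c] and [K] and does not split [K]; they dominate the others elsewhere. *)
Definition facet_point (R : realType) (n : nat) (a b c r : 'I_n) (K : {set 'I_n})
    (yb yr yc : R) : 'rV[R]_n :=
  \row_v (- 4 * (v == a)%:R + yb * (v == b)%:R + yr * (v == r)%:R + yc * (v == c)%:R
          + 16 * ((v \in K)%:R - #|K|%:R * (v == r)%:R
                  + #|K|%:R * (v \notin [set a; b; c] :|: K)%:R)).

Lemma sum_indicator (R : realType) (T : finType) (J K : {set T}) :
  \sum_(v in J) (v \in K)%:R = #|J :&: K|%:R :> R.
Proof.
rewrite -sum1_card natr_sum big_mkcond [RHS]big_mkcond /=.
by apply: eq_bigr => v _; rewrite inE; case: (v \in J); case: (v \in K).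
Qed.

Lemma sum_indicator1 (R : realType) (T : finType) (J : {set T}) (a : T) :
  \sum_(v in J) (v == a)%:R = (a \in J)%:R :> R.
Proof.
have [aJ|aJ] := boolP (a \in J).
  rewrite (bigD1 a) //= eqxx big1 ?addr0 // => v /andP[_ /negPf -> //].
by rewrite big1 // => v vJ; case: eqP vJ aJ => // -> ->.
Qed.

Lemma subset_sum_facet_point (R : realType) (n : nat) (a b c r : 'I_n) (K J : {set 'I_n})
    (yb yr yc : R) :
  subset_sum J (facet_point a b c r K yb yr yc) =
  - 4 * (a \in J)%:R + yb * (b \in J)%:R + yr * (r \in J)%:R + yc * (c \in J)%:R
  + 16 * (#|J :&: K|%:R - #|K|%:R * (r \in J)%:R
          + #|K|%:R * #|J :\: ([set a; b; c] :|: K)|%:R).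
Proof.
rewrite /subset_sum; under eq_bigr do rewrite mxE.
rewrite !big_split /= -!mulr_sumr !sum_indicator1 big_split big_split /=.
rewrite sumrN -!mulr_sumr sum_indicator1 sum_indicator finset.setDE.
rewrite -(sum_indicator R J (~: _)).
by congr (_ + 16 * (_ + _ * _)); apply: eq_bigr => v _; rewrite finset.in_setC.
Qed.

(** [q] is an integer. A vertex outside [a], [b], [c] and [K] outweighs the deficit of [K], which is
    at most [#|K| - 1] since [r] itself is counted. Without such a vertex, [q = 0] means that [J]
    contains all of [K] or none of it. *)
Lemma facet_point_cases (R : realType) (n : nat) (a b c r : 'I_n) (K J : {set 'I_n})
    (q : R) :
  r \in K ->
  q = #|J :&: K|%:R - #|K|%:R * (r \in J)%:R
          + #|K|%:R * #|J :\: ([set a; b; c] :|: K)|%:R ->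
  [\/ 1 <= q, q <= -1 |
      q = 0 /\ J \subset [set a; b; c] :|: K /\ J :&: K = if r \in J then K else finset.set0].
Proof.
move=> rK ->; have K0 : (0 < #|K|)%N by apply/card_gt0P; exists r.
have mK : (#|J :&: K| <= #|K|)%N by rewrite subset_leq_card ?finset.subsetIr.
have [out0|out1] := posnP (#|J :\: ([set a; b; c] :|: K)|); last first.
  apply: Or31; have [rJ|rJ] := boolP (r \in J); rewrite /= ?mulr1 ?mulr0 -natrM.
    have m0 : (0 < #|J :&: K|)%N by apply/card_gt0P; exists r; rewrite inE rJ.
    have : (1 + #|K| <= #|J :&: K| + #|K| * #|J :\: ([set a; b; c] :|: K)|)%N by nia.
    by rewrite -(ler_nat R) !natrD; lra.
  have : (1 <= #|J :&: K| + #|K| * #|J :\: ([set a; b; c] :|: K)|)%N by nia.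
  by rewrite -(ler_nat R) natrD; lra.
have JS : J \subset [set a; b; c] :|: K by rewrite -finset.setD_eq0 -cards_eq0 out0.
rewrite out0 mulr0 addr0; have [rJ|rJ] := boolP (r \in J); rewrite /= ?mulr1 ?mulr0 ?subr0.
  have [mk|mk] := eqVneq (#|J :&: K|) (#|K|).
    apply: Or33; rewrite mk subrr; split=> //; split=> //.
    by apply/eqP; rewrite eqEcard finset.subsetIr mk leqnn.
  have : (#|J :&: K| + 1 <= #|K|)%N by rewrite addn1 ltn_neqAle mk.
  by rewrite -(ler_nat R) natrD => ?; apply: Or32; lra.
have [m0|m0] := posnP (#|J :&: K|).
  by apply: Or33; rewrite m0; split=> //; split=> //; apply/eqP; rewrite -cards_eq0 m0.
by apply: Or31; rewrite (ler_nat R 1).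
Qed.

(** The four facets of the chamber; a pair of bits serves as the finite index type in
    [dependent_walls_not_simplicial]. *)
Definition facet_set (n : nat) (a b c : 'I_n) (K : {set 'I_n}) (i : bool * bool) : {set 'I_n} :=
  [set a; if i.1 then b else c] :|: (if i.2 then K else finset.set0).

(** The base point has values 3, 3, 3 against -4 at [a]. Lowering two values to 2 gives a pair with
    sum 4, raising one to 4 meets the upper bound; all other inequalities stay strict. *)
Definition facet_witness (R : realType) (n : nat) (a b c r : 'I_n) (K : {set 'I_n})
    (i : bool * bool) : 'rV[R]_n :=
  facet_point a b c r K
    (if i.1 then if i.2 then 2 else 4 else 3) (if i.2 then 2 else 3)
    (if i.1 then 3 else if i.2 then 2 else 4).

(** The small terms add up to a number between -4 and 10, so 16 times a nonzero integer fixes both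
    signs. If that integer is 0, only the traces of [J] on [a], [b], [c], [r] matter, and they are
    checked one by one. *)
Lemma facet_witness_sign (R : realType) (n : nat) (e : rel 'I_n) (a b c r : 'I_n)
    (K J : {set 'I_n}) (i : bool * bool) :
  obstruction e a b c K -> r \in K -> J != finset.set0 -> J != facet_set a b c K i ->
  0 < subset_sum J (facet_witness R a b c r K i)
      * subset_sum J (facet_point a b c r K 3 3 3 : 'rV[R]_n).
Proof.
case=> uabc [aK bK cK] _ _ _ rK J0 Ji.
rewrite /facet_witness !subset_sum_facet_point.
set q := (_ + #|K|%:R * _).
have := @facet_point_cases R n a b c r K J q rK erefl.
move: q => q; have bit (t : bool) : 0 <= (t%:R : R) <= 1 by case: t; rewrite /= ?lexx ler01.
move: (bit (a \in J)) (bit (b \in J)) (bit (c \in J)) (bit (r \in J)).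
move=> /andP[a0 a1] /andP[b0 b1] /andP[c0 c1] /andP[r0 r1] [q1|q1|[-> [JS JK]]].
- by apply: mulr_gt0; case: (i) => [[] []] /=; lra.
- by rewrite -mulrNN; apply: mulr_gt0; case: (i) => [[] []] /=; lra.
clear a0 a1 b0 b1 c0 c1 r0 r1 bit.
have JE v : (v \in J) = [|| (v == a) && (a \in J), (v == b) && (b \in J),
                            (v == c) && (c \in J) | (v \in K) && (r \in J)].
  have [->|va] := eqVneq v a.
    move: uabc; rewrite /= !inE negb_or => /andP[/andP[/negPf-> /negPf->] _].
    by rewrite (negPf aK) /= !orbF.
  have [->|vb] := eqVneq v b.
    move: uabc; rewrite /= !inE negb_or => /and3P[_ /negPf-> _].
    by rewrite (negPf bK) /= !orbF.
  have [->|vc] := eqVneq v c; first by rewrite (negPf cK) /= !orbF.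
  have [vK|vK] /= := boolP (v \in K).
    have : (v \in J :&: K) = (v \in J) by rewrite inE vK andbT.
    by rewrite JK => <-; case: ifP; rewrite ?inE.
  apply/negP => /(fintype.subsetP JS).
  by rewrite !inE (negPf va) (negPf vb) (negPf vc) (negPf vK).
(* Read on the four bits: [J] is neither empty nor the facet set, the two traces at which the
   witness form vanishes. *)
suff : [|| a \in J, b \in J, c \in J | r \in J] /\
       ~~ [&& a \in J, (b \in J) == i.1, (c \in J) == ~~ i.1 & (r \in J) == i.2].
  clear; case.
  by case: (a \in J); case: (b \in J); case: (c \in J); case: (r \in J);
    case: (i) => [[] []] //= _ _;
    first [by apply: mulr_gt0; lra | by rewrite -mulrNN; apply: mulr_gt0; lra].
split.
  apply: contraNT J0; rewrite !negb_or => /and4P[/negPf ja /negPf jb /negPf jc /negPf jr].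
  by apply/eqP/setP => v; rewrite JE ja jb jc jr !andbF inE.
apply: contraNN Ji => /and4P[ja /eqP jb /eqP jc /eqP jr].
apply/eqP/setP => v; rewrite JE /facet_set ja jb jc jr.
by case: (i) => [[] []] /=; rewrite !inE ?andbT ?andbF ?orbF ?orbA ?orbF.
Qed.

Lemma facet_witness_zero (R : realType) (n : nat) (e : rel 'I_n) (a b c r : 'I_n)
    (K : {set 'I_n}) (i : bool * bool) :
  obstruction e a b c K -> r \in K ->
  subset_sum (facet_set a b c K i) (facet_witness R a b c r K i) = 0.
Proof.
case=> uabc [aK bK cK] _ _ _ rK.
have [ab ac bc] : [/\ a != b, a != c & b != c].
  by move: uabc; rewrite /= !inE negb_or => /andP[/andP[-> ->] /andP[-> _]].
have rE v : v \notin K -> r == v = false.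
  by move=> vnK; apply/negbTE; apply: contraNneq vnK => <-.
rewrite /facet_witness subset_sum_facet_point.
have -> : facet_set a b c K i :\: ([set a; b; c] :|: K) = finset.set0.
  apply/setP => v; rewrite /facet_set !inE.
  case: (i) => [[] []] /=; rewrite ?inE; 
    by case: (v == a); case: (v == b); case: (v == c); case: (v \in K).
have -> : facet_set a b c K i :&: K = if i.2 then K else finset.set0.
  apply/setP => v; rewrite /facet_set !inE; have [vK|] := boolP (v \in K); last first.
    by case: (i.2); rewrite ?inE ?andbF // => /negPf ->.
  rewrite andbT; case: (i.2); rewrite ?inE ?vK ?orbT ?orbF //.
  by apply/negbTE; rewrite negb_or; apply/andP; split; case: (i.1);
    apply: contraTneq vK => ->.
rewrite /facet_set !inE; case: (i) => [[] []] /=;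
  rewrite ?inE ?cards0 ?rK ?eqxx ?(negPf aK) ?(negPf bK) ?(negPf cK)
    ?(rE a) ?(rE b) ?(rE c) // 1?[b == a]eq_sym 1?[c == a]eq_sym 1?[c == b]eq_sym
    ?(negPf ab) ?(negPf ac) ?(negPf bc) /=; lra.
Qed.

Lemma facet_set_connected (n : nat) (e : rel 'I_n) (a b c : 'I_n) (K : {set 'I_n})
    (i : bool * bool) :
  symmetric e -> obstruction e a b c K -> induced_connected e (facet_set a b c K i).
Proof.
move=> sym_e [_ _ _ [eab eac] [cb cc]].
have edge u v : e u v -> induced_connected e [set u; v].
  move=> euv; split; first by apply/set0Pn; exists u; rewrite !inE eqxx.
  move=> x y; rewrite !inE => /orP[]/eqP-> /orP[]/eqP-> //; apply: connect1;
    by rewrite /= !inE !eqxx ?orbT ?andbT // sym_e.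
rewrite /facet_set; case: i => [[] []] //=; rewrite finset.setU0; exact: edge.
Qed.

Lemma facet_set_inj (n : nat) (e : rel 'I_n) (a b c : 'I_n) (K : {set 'I_n}) :
  obstruction e a b c K -> injective (facet_set a b c K).
Proof.
case=> uabc [aK bK cK] /set0Pn[r rK] _ _ i j /setP ij.
have [ab ac bc] : [/\ a != b, a != c & b != c].
  by move: uabc; rewrite /= !inE negb_or => /andP[/andP[-> ->] /andP[-> _]].
have rE v : v \notin K -> r == v = false.
  by move=> vnK; apply/negbTE; apply: contraNneq vnK => <-.
move: (ij b) (ij r); rewrite /facet_set.
case: i {ij} => [[] []]; case: j => [[] []] //=;
  by rewrite !inE ?eqxx ?rK ?(rE a) ?(rE b) ?(rE c) // 1?[b == a]eq_sym
    ?(negPf ab) ?(negPf bc) ?(negPf bK) //=.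
Qed.

Lemma obstruction_not_simplicial (R : realType) (n : nat) (e : rel 'I_n) (a b c : 'I_n)
    (K : {set 'I_n}) :
  symmetric e -> obstruction e a b c K -> ~ simplicial_complement (@csa_complement R n e).
Proof.
move=> sym_e ob simpl; have [r rK] : exists r, r \in K.
  by apply/set0Pn; case: ob.
pose x : 'rV[R]_n := facet_point a b c r K 3 3 3.
pose I := facet_set a b c K.
have Iinj : injective I := facet_set_inj ob.
have Mx : csa_complement e x.
  apply/csa_complementE => J [J0 _].
  (* The sets [I i] are distinct, so [J] differs from one of them, and the sign at its witness
     forces a nonzero value at [x]. *)
  have [i Ji] : exists i, J != I i.
    have [J1|] := eqVneq J (I (true, true)); last by exists (true, true).
    by exists (true, false); rewrite J1; apply/eqP => /Iinj.
  have := facet_witness_sign R ob rK J0 Ji.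
  by apply: contraTneq => ->; rewrite mulr0 ltxx.
have := simpl _ Mx; rewrite connected_component_csa //.
apply: (@dependent_walls_not_simplicial R n e _ x
          (facet_witness R a b c r K) I (true, true)) => //.
- by move=> i; apply: facet_set_connected.
- by move=> i; exact: (facet_witness_zero R i ob rK).
- by move=> i J [J0 _] Ji; exact: (facet_witness_sign R ob rK J0 Ji).
- move=> y y0; case: ob => _ [aK bK cK] _ _ _.
  (* Adding [K] changes the forms of [{a,b}] and [{a,c}] by the same amount; this is the linear
     relation between the four walls. *)
  have sumU (i : bool) : subset_sum (I (i, true)) y = subset_sum (I (i, false)) y + subset_sum K y.
    rewrite /subset_sum (big_setID K) addrC; congr (_ + _); apply: eq_bigl => v.
      by rewrite /I /facet_set !inE; case: (v \in K); rewrite ?andbF ?orbT.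
    rewrite /I /facet_set /= finset.setU0 !inE; have [vK|] //= := boolP (v \in K).
      apply/esym/negbTE; rewrite negb_or; apply/andP; split; case: (i);
        by apply: contraTneq vK => ->.
    by rewrite orbF.
  have := sumU false; rewrite !(y0 (false, _)) // add0r => K0.
  by rewrite sumU (y0 (true, false)) // -K0 addr0.
Qed.

(** * Connected graphs without an obstruction *)

Lemma path_induced_connected (n : nat) (e : rel 'I_n) (x : 'I_n) (p : seq 'I_n)
    (S : {set 'I_n}) :
  symmetric e -> path e x p -> S =i x :: p -> induced_connected e S.
Proof.
move=> sym_e xp Sxp; pose e' := [rel u v | [&& e u v, u \in S & v \in S]].
have sym_e' : symmetric e' by move=> u v /=; rewrite sym_e [(v \in S) && _]andbC.
have xp' : path e' x p.
  apply: (@sub_in_path _ (mem S) e) xp => [u v uS vS euv|]; first by rewrite /= euv uS.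
  by apply/allP => v; rewrite -Sxp.
split; first by apply/set0Pn; exists x; rewrite Sxp mem_head.
move=> u v; rewrite !Sxp => /(path_connect xp') xu /(path_connect xp').
by apply: connect_trans; rewrite sym_connect_sym.
Qed.

Lemma degree3_obstruction (n : nat) (e : rel 'I_n) (a b c d : 'I_n) :
  simple_graph e -> uniq [:: b; c; d] -> e a b -> e a c -> e a d ->
  obstruction e a b c [set d].
Proof.
move=> [sym_e irr_e] ubcd eab eac ead.
have neq u : e a u -> a != u by apply: contraTneq => <-; rewrite irr_e.
move: ubcd; rewrite /= !inE negb_or andbT => /andP[/andP[bc bd] cd].
split=> //.
- by rewrite /= !inE negb_or !neq // bc.
- by rewrite !inE bd cd neq.
- by apply/set0Pn; exists d; rewrite inE.
- split; [apply: (@path_induced_connected _ _ b [:: a; d])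
         |apply: (@path_induced_connected _ _ c [:: a; d])] => //=;
  rewrite ?[e _ a]sym_e ?eab ?eac ?ead // => v; rewrite !inE;
  by case: (v == a); case: (v == d); rewrite ?orbT.
Qed.

(** [K] is the arc of the cycle strictly between the two neighbours [b] and [y] of [a]; it is
    nonempty because the cycle has at least four vertices. *)
Lemma cycle_obstruction (n : nat) (e : rel 'I_n) (a b x y : 'I_n) (s : seq 'I_n) :
  symmetric e -> uniq (a :: b :: x :: rcons s y) ->
  path e a (b :: x :: rcons s y) -> e y a -> obstruction e a b y [set v in x :: s].
Proof.
move=> sym_e us /= /and3P[eab ebx]; rewrite rcons_path => /andP[xs sy] eya.
have mem_rcons' v : (v \in rcons s y) = (v == y) || (v \in s) by rewrite mem_rcons inE.
move: us; rewrite /= !inE !mem_rcons' rcons_uniq !negb_or.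
move=> /and5P[/and4P[ab ax ay aS] /and3P[bx by_ bS] /andP[xy xS] yS us].
split.
- by rewrite /= !inE negb_or ab ay by_.
- by rewrite !inE !negb_or ax aS bx bS yS eq_sym xy.
- by apply/set0Pn; exists x; rewrite !inE eqxx.
- by rewrite eab sym_e.
- split.
    apply: (@path_induced_connected _ _ a [:: b, x & s]) => //=; first by rewrite eab ebx.
    by move=> v; rewrite !inE -!orbA.
  apply: (@path_induced_connected _ _ x (rcons (rcons s y) a)) => //=.
    by rewrite !rcons_path xs sy last_rcons.
  move=> v; rewrite !inE mem_rcons inE mem_rcons' -!orbA.
  by case: (v == a); case: (v == y); rewrite //= ?orbT.
Qed.

Lemma longest_path (n : nat) (e : rel 'I_n) :
  exists s : seq 'I_n, [/\ uniq s, sorted e s &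
    forall t, uniq t -> sorted e t -> (size t <= size s)%N].
Proof.
pose P k := `[< exists s : seq 'I_n, [/\ uniq s, sorted e s & size s = k] >].
have P0 : exists k, P k by exists 0%N; apply/asboolP; exists [::].
have Pn k : P k -> (k <= n)%N.
  by move=> /asboolP[s [us _ <-]]; have := uniq_leq_size us (fun v _ => mem_enum 'I_n v);
    rewrite size_enum_ord.
case: (ex_maxnP P0 Pn) => k /asboolP[s [us ss <-]] kmax; exists s; split=> // t ut st.
by apply: kmax; apply/asboolP; exists t.
Qed.

(** Without an obstruction no vertex has three neighbours. A longest path then visits every vertex,
    and the only edge outside it can join its two ends, closing a cycle: a triangle, or an
    obstruction when longer. *)
Lemma path_triangle_or_obstruction (n : nat) (e : rel 'I_n) :
  simple_graph e -> graph_connected e ->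
  [\/ is_triangle e, is_path_graph e | exists a b c K, obstruction e a b c K].
Proof.
move=> simple_e [/set0Pn[x0 _] conn_e]; have [sym_e irr_e] := simple_e.
have [ob|nob] := pselect (exists a b c K, obstruction e a b c K); first exact: Or33.
have deg2 a b c d : uniq [:: b; c; d] -> e a b -> e a c -> ~~ e a d.
  move=> ubcd eab eac; apply/negP => ead; apply: nob.
  by exists a, b, c, [set d]; apply: degree3_obstruction.
have [s [us ss smax]] := longest_path e.
pose v i := nth x0 s i.
have ev i : (i.+1 < size s)%N -> e (v i) (v i.+1) by move/(sortedP x0): ss; apply.
have ev' i : (0 < i)%N -> (i < size s)%N -> e (v i) (v i.-1).
  by case: i => // i _ /ev; rewrite sym_e.
have vinj i j : (i < size s)%N -> (j < size s)%N -> (v i == v j) = (i == j).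
  by move=> si sj; rewrite /v nth_uniq.
have s0 : (0 < size s)%N by apply: (smax [:: x0]).
have cons_sorted w t : (0 < size t)%N -> sorted e t -> e w (nth x0 t 0) -> sorted e (w :: t).
  by case: t => //= y t _ -> ->.
have rcons_sorted w t :
    (0 < size t)%N -> sorted e t -> e (nth x0 t (size t).-1) w -> sorted e (rcons t w).
  by rewrite nth_last; case: t => //= y t _; rewrite rcons_path => -> ->.
have spans w : w \in s.
  apply: contrapT => /negP ws.
  (* The path is closed under adjacency: a new neighbour would prolong it at an end, or be a third
     neighbour of an inner vertex. *)
  have clos : fingraph.closed [rel u v | [&& e u v, u \in [set: 'I_n] & v \in [set: 'I_n]]]
                (mem s).
    apply: (intro_closed (sym_connect_sym _)) => [u u'|u u'] /=.
      by rewrite !inE sym_e.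
    rewrite !inE !andbT => euu' us'; apply: contrapT => /negP u's.
    move: (us') euu'; rewrite -index_mem => si.
    rewrite -[u](nth_index x0 us') -/(v _).
    move: (index u s) si => i si.
    have u'v j : (j < size s)%N -> v j != u'.
      by move=> sj; apply: contraNneq u's => <-; apply: mem_nth.
    have [i0|i0] := posnP i.
      rewrite i0 sym_e => e0; have := smax (u' :: s).
      by rewrite cons_uniq u's us cons_sorted //= ltnn => /(_ isT isT).
    have [sl|sl] := ltnP i.+1 (size s).
      move=> /idP; apply/negP; apply: (deg2 _ (v i.-1) (v i.+1)).
      - by rewrite /= !inE negb_or vinj ?u'v //; lia.
      - exact: ev'.
      - exact: ev.
    have -> : i = (size s).-1 by apply/eqP; rewrite -eqSS prednK // eqn_leq sl andbT.
    move=> e1; have := smax (rcons s u').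
    by rewrite rcons_uniq u's us rcons_sorted //= size_rcons ltnn => /(_ isT isT).
  have := closed_connect clos (conn_e (v 0%N) w (finset.in_setT _) (finset.in_setT _)).
  by rewrite /= (negPf ws) mem_nth.
have sn : size s = n.
  by rewrite -[RHS]card_ord -(card_uniqP us); apply: eq_card => w; rewrite spans.
(* Any pair other than the two ends includes an inner vertex, whose two neighbours on the path are
   its only ones. *)
have chord i j : (i < j)%N -> (j < size s)%N -> (0 < i)%N || (j < (size s).-1)%N ->
    e (v i) (v j) = (i.+1 == j).
  move=> ij js ij0; have [<-|ne] := eqVneq i.+1 j; first by rewrite ev //; lia.
  apply/negbTE; have [i0|i0] := posnP i.
    rewrite sym_e; apply: (deg2 _ (v j.-1) (v j.+1)).
    - by rewrite /= !inE negb_or !vinj; lia.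
    - by apply: ev'; lia.
    - by apply: ev; lia.
  apply: (deg2 _ (v i.-1) (v i.+1)).
  - by rewrite /= !inE negb_or !vinj; lia.
  - by apply: ev'; lia.
  - by apply: ev; lia.
(* With at most two vertices the ends are equal or already consecutive, so only a longer path can
   close into a cycle. *)
have [/andP[n3 closing]|open_path] := boolP ((2 < size s)%N && e (v 0%N) (v (size s).-1)).
  have [s3|s3] := eqVneq (size s) 3%N; last first.
    case: nob; move: closing n3 s3 us ss; rewrite /v nth_last.
    move: {v ev ev' vinj chord smax s0 spans sn} s => [//|a [//|b [//|x s]]]; case/lastP: s => // s y.
    rewrite /= last_rcons sym_e => eya _ _ us ss.
    by exists a, b, y, [set v in x :: s]; apply: cycle_obstruction.
  apply: Or31; split; first by rewrite -sn.
  move=> x y; rewrite -(nth_index x0 (spans x)) -(nth_index x0 (spans y)) -!/(v _).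
  move: (spans x) (spans y); rewrite -!index_mem => sx sy; rewrite vinj //.
  move: (ev 0%N) (ev 1%N) closing; rewrite s3 => /(_ isT) e01 /(_ isT) e12 e02.
  move: sx sy; rewrite s3; case: (index x s) => [|[|[|]]] //; case: (index y s) => [|[|[|]]] //;
    by rewrite ?irr_e // [e _ _]sym_e.
apply: Or32; exists (fun i => v i); split.
  apply: injF_bij => i j /eqP; rewrite vinj ?sn ?ltn_ord //.
  by move=> /eqP/val_inj.
have adj i j : (i < j)%N -> (j < size s)%N -> e (v i) (v j) = (i.+1 == j).
  move=> ij js; have [|/norP[i0 js']] := boolP ((0 < i)%N || (j < (size s).-1)%N).
    exact: chord.
  have ->: i = 0%N by lia.
  have [<-|j1] := eqVneq 1%N j; first by rewrite ev //; lia.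
  apply/negbTE; move: open_path; rewrite negb_and -leqNgt.
  have -> : (size s).-1 = j by lia.
  by case/orP => //; lia.
move=> i j; case: (ltngtP i j) => [ij|ji|/val_inj ->].
- by rewrite adj ?sn ?ltn_ord //; lia.
- by rewrite sym_e adj ?sn ?ltn_ord //; lia.
- by rewrite irr_e; lia.
Qed.

(** * Bounding forms for the triangle *)

Lemma uniq3_enum (i j k : 'I_3) : uniq [:: i; j; k] -> perm_eq (enum 'I_3) [:: i; j; k].
Proof.
move=> ijk; rewrite perm_sym; apply: uniq_perm; rewrite ?enum_uniq //.
have [||//] := uniq_min_size ijk (s2 := enum 'I_3); last by rewrite size_enum_ord.
by move=> l _; rewrite mem_enum.
Qed.

Lemma subset_sum3 (R : realType) (i j k : 'I_3) (J : {set 'I_3}) (y : 'rV[R]_3) :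
  uniq [:: i; j; k] ->
  subset_sum J y = (i \in J)%:R * y ord0 i + (j \in J)%:R * y ord0 j
                   + (k \in J)%:R * y ord0 k.
Proof.
move=> /uniq3_enum ijk; rewrite /subset_sum big_mkcond -big_enum (perm_big _ ijk) /=.
by rewrite !big_cons big_nil addr0 addrA; congr (_ + _ + _); case: ifP; rewrite ?mul1r ?mul0r.
Qed.

Lemma complete3_frame (R : realType) (e : rel 'I_3) (x : 'rV[R]_3) (A B C : {set 'I_3}) :
  (forall J, induced_connected e J <-> J != finset.set0) ->
  [/\ A != finset.set0, B != finset.set0 & C != finset.set0] ->
  (forall y : 'rV[R]_3,
     [/\ subset_sum A y = 0, subset_sum B y = 0 & subset_sum C y = 0] -> y = 0) ->
  (forall y : 'rV[R]_3,
     [/\ 0 < subset_sum A y * subset_sum A x, 0 < subset_sum B y * subset_sum B x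
       & 0 < subset_sum C y * subset_sum C x] ->
     forall J, J != finset.set0 -> 0 < subset_sum J y * subset_sum J x) ->
  exists I, simplicial_frame e x I.
Proof.
move=> conn [A0 B0 C0] inj sgn.
pose I (m : 'I_3) := nth finset.set0 [:: A; B; C] m.
exists I; split.
- by case=> [[|[|[|//]]] m3]; apply/conn.
- move=> y y0; apply: inj; split.
  + exact: y0 (@Ordinal 3 0 isT).
  + exact: y0 (@Ordinal 3 1 isT).
  + exact: y0 (@Ordinal 3 2 isT).
- move=> y y0 J /conn; apply: sgn; split.
  + exact: y0 (@Ordinal 3 0 isT).
  + exact: y0 (@Ordinal 3 1 isT).
  + exact: y0 (@Ordinal 3 2 isT).
Qed.

(** Bit triples encode the subsets of three vertices, which turns the case analysis into linear
    arithmetic in three reals. *)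
Definition triple_sum (R : realFieldType) (D : bool * bool * bool) (a b c : R) : R :=
  D.1.1%:R * a + D.1.2%:R * b + D.2%:R * c.

(** [simplicial_frame] in coordinates for the triangle, where every nonempty set is connected. *)
Definition triple_frame (R : realFieldType) (A B C : bool * bool * bool) (x y z : R) : Prop :=
  [/\ [/\ A != (false, false, false), B != (false, false, false) & C != (false, false, false)],
      forall a b c : R,
        [/\ triple_sum A a b c = 0, triple_sum B a b c = 0 & triple_sum C a b c = 0] ->
        [/\ a = 0, b = 0 & c = 0] &
      forall a b c : R,
        [/\ 0 < triple_sum A a b c * triple_sum A x y z,
            0 < triple_sum B a b c * triple_sum B x y z
          & 0 < triple_sum C a b c * triple_sum C x y z] ->
        forall D, D != (false, false, false) ->
          0 < triple_sum D a b c * triple_sum D x y z].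

Lemma mulr_gt0_left (R : realFieldType) (s t : R) : 0 < t * s -> 0 < s -> 0 < t.
Proof. by move=> ts s0; move: ts; rewrite mulrC pmulr_rgt0. Qed.

Lemma mulr_gt0_left_neg (R : realFieldType) (s t : R) : 0 < t * s -> s < 0 -> t < 0.
Proof. by move=> ts s0; move: ts; rewrite mulrC nmulr_rgt0. Qed.

(** The context fixes the sign of each bounding form at [(x, y, z)], hence at [(a, b, c)]; the seven
    nonzero forms are then compared one by one. *)
Ltac triple_signs :=
  rewrite /triple_sum /=; case; do 3 (let h := fresh "h" in move=> h;
    first [have {}h := mulr_gt0_left h ltac:(lra) | have {}h := mulr_gt0_left_neg h ltac:(lra)]);
  case=> [[[] []] []] // _ /=;
  first [by apply: mulr_gt0; lra | by rewrite -mulrNN; apply: mulr_gt0; lra].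

(* Which three forms bound the chamber depends on the position of [z] relative to
   [0], [- y], [- x] and [- (x + y)]. *)
Lemma exists_triple_frame (R : realFieldType) (x y z : R) :
  0 < x -> 0 < y -> y <= x -> z != 0 -> x + z != 0 -> y + z != 0 -> x + y + z != 0 ->
  exists A B C, triple_frame A B C x y z.
Proof.
move=> x0 y0 yx; case: (ltgtP 0 z) => [z0|z0|//] _ nxz nyz nxyz.
  clear nxz nyz nxyz.
  exists (true, false, false), (false, true, false), (false, false, true); split=> //.
    by move=> a b c; rewrite /triple_sum /= => -[]; split; lra.
  by move=> a b c; triple_signs.
move: nxz nyz nxyz; case: (ltgtP 0 (x + y + z)) => [s0|s0|//] nxz nyz _; last first.
  clear nxz nyz.
  exists (true, false, false), (false, true, false), (true, true, true); split=> //.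
    by move=> a b c; rewrite /triple_sum /= => -[]; split; lra.
  by move=> a b c; triple_signs.
(* As [y <= x], a negative [x + z] makes [y + z] negative too, so three cases remain. *)
move: nxz nyz; case: (ltgtP 0 (x + z)) => [xz0|xz0|//] _ nyz; last first.
  clear nyz.
  exists (true, false, true), (false, true, true), (true, true, true); split=> //.
    by move=> a b c; rewrite /triple_sum /= => -[]; split; lra.
  by move=> a b c; triple_signs.
move: nyz; case: (ltgtP 0 (y + z)) => [yz0|yz0|//] _; last first.
  exists (true, false, true), (false, true, false), (false, true, true); split=> //.
    by move=> a b c; rewrite /triple_sum /= => -[]; split; lra.
  by move=> a b c; triple_signs.
exists (true, false, true), (false, true, true), (false, false, true); split=> //.
  by move=> a b c; rewrite /triple_sum /= => -[]; split; lra.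
by move=> a b c; triple_signs.
Qed.

Lemma complete3_frame_coord (R : realType) (e : rel 'I_3) (x : 'rV[R]_3) (i j k : 'I_3)
    (A B C : bool * bool * bool) :
  (forall J, induced_connected e J <-> J != finset.set0) ->
  uniq [:: i; j; k] -> triple_frame A B C (x ord0 i) (x ord0 j) (x ord0 k) ->
  exists I, simplicial_frame e x I.
Proof.
move=> conn ijk [[A0 B0 C0] inj sgn].
have sumE (J : {set 'I_3}) (y : 'rV[R]_3) :
    subset_sum J y = triple_sum (i \in J, j \in J, k \in J) (y ord0 i) (y ord0 j) (y ord0 k).
  by rewrite (subset_sum3 _ _ ijk).
have cover l : l \in [:: i; j; k] by rewrite -(perm_mem (uniq3_enum ijk)) mem_enum.
pose S (D : bool * bool * bool) : {set 'I_3} :=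
  [set l | [|| D.1.1 && (l == i), D.1.2 && (l == j) | D.2 && (l == k)]].
have memS D : (i \in S D, j \in S D, k \in S D) = D.
  move: ijk; rewrite /= !inE negb_or => /andP[/andP[/negPf ij /negPf ik] /andP[/negPf jk _]].
  by rewrite !eqxx [j == i]eq_sym [k == i]eq_sym [k == j]eq_sym ij ik jk !andbF !andbT
             !orbF /=; case: D => [[]].
have S0 D : D != (false, false, false) -> S D != finset.set0.
  by apply: contraNneq => SD; rewrite -(memS D) SD !inE.
have SJ (J : {set 'I_3}) : S (i \in J, j \in J, k \in J) = J.
  apply/setP => l; rewrite inE /=; move: (cover l); rewrite !inE.
  move: ijk; rewrite /= !inE negb_or => /andP[/andP[/negPf ij /negPf ik] /andP[/negPf jk _]].
  by case/or3P => /eqP ->; rewrite !eqxx 1?[j == i]eq_sym 1?[k == i]eq_sym 1?[k == j]eq_sym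
    ?ij ?ik ?jk ?andbF ?andbT ?orbF.
apply: (@complete3_frame R e x (S A) (S B) (S C)) => //.
- by split; apply: S0.
- move=> y; rewrite !sumE !memS => /inj[yi yj yk].
  apply/rowP => l; rewrite mxE; move: (cover l); rewrite !inE.
  by case/or3P => /eqP ->.
- move=> y; rewrite !sumE !memS => /sgn h J J0; rewrite !sumE; apply: h.
  by apply: contraNneq J0 => JE; rewrite -(SJ J) JE; apply/eqP/setP => l; rewrite !inE.
Qed.

Lemma complete3_frame_pos (R : realType) (e : rel 'I_3) (x : 'rV[R]_3) (i j k : 'I_3) :
  (forall J, induced_connected e J <-> J != finset.set0) ->
  csa_complement e x -> uniq [:: i; j; k] -> 0 < x ord0 i -> 0 < x ord0 j ->
  exists I, simplicial_frame e x I.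
Proof.
move=> conn /csa_complementE Mx; wlog xij : i j / x ord0 j <= x ord0 i.
  move=> wl ijk i0 j0; have [ji|ij] := leP (x ord0 j) (x ord0 i); first exact: (wl i j).
  apply: (wl j i) => //; first exact: ltW.
  by move: ijk; rewrite /= !inE !negb_or [j == i]eq_sym;
    case: (i == j); case: (i == k); case: (j == k).
move=> ijk i0 j0.
have nz (J : {set 'I_3}) l : l \in J -> subset_sum J x != 0.
  by move=> lJ; apply/Mx/conn/set0Pn; exists l.
have nzk := nz [set k] k; have nzik := nz [set i; k] k.
have nzjk := nz [set j; k] k; have nzijk := nz [set i; j; k] k.
move: (ijk); rewrite /= !inE negb_or => /andP[/andP[/negPf ij /negPf ik] /andP[/negPf jk _]].
move: nzk nzik nzjk nzijk; rewrite !(subset_sum3 _ _ ijk) !inE !eqxx.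
rewrite [j == i]eq_sym [k == i]eq_sym [k == j]eq_sym ij ik jk /= !mul1r !mul0r !add0r !addr0.
move=> /(_ isT) nk /(_ isT) nik /(_ isT) njk /(_ isT) nijk.
have [A [B [C ABC]]] := exists_triple_frame i0 j0 xij nk nik njk nijk.
exact: complete3_frame_coord conn ijk ABC.
Qed.

Lemma csa_complementN (R : realType) (n : nat) (e : rel 'I_n) (x : 'rV[R]_n) :
  csa_complement e x -> csa_complement e (- x).
Proof.
by move=> /csa_complementE Mx; apply/csa_complementE => J /Mx; rewrite subset_sumN oppr_eq0.
Qed.

Lemma simplicial_frameN (R : realType) (n : nat) (e : rel 'I_n) (x : 'rV[R]_n)
    (I : 'I_n -> {set 'I_n}) :
  simplicial_frame e (- x) I -> simplicial_frame e x I.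
Proof.
case=> cI inj sgn; split=> // y y0 J cJ.
have /(_ J cJ) : chamber e (- x) (- y).
  by apply: sgn => k; rewrite !subset_sumN mulrNN.
by rewrite !subset_sumN mulrNN.
Qed.

(** Two of three nonzero coordinates share a sign; negating the point, which preserves frames, makes
    them positive. *)
Lemma triangle_frame (R : realType) (e : rel 'I_3) (x : 'rV[R]_3) :
  (forall u v, e u v = (u != v)) -> csa_complement e x ->
  exists I, simplicial_frame e x I.
Proof.
move=> eE Mx.
have conn J : induced_connected e J <-> J != finset.set0.
  split=> [[]//|J0]; split=> // u v uJ vJ.
  have [->|uv] := eqVneq u v; first exact: connect0.
  by apply: connect1; rewrite /= eE uv uJ.
pose a := @Ordinal 3 0 isT; pose b := @Ordinal 3 1 isT; pose c := @Ordinal 3 2 isT.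
have x0 l : x ord0 l != 0.
  have /conn cl : [set l] != finset.set0 by apply/set0Pn; exists l; rewrite inE.
  by move/csa_complementE: Mx => /(_ _ cl); rewrite /subset_sum big_set1.
have pos i j k : uniq [:: i; j; k] -> 0 < x ord0 i -> 0 < x ord0 j ->
    exists I, simplicial_frame e x I.
  by move=> ijk i0 j0; apply: (complete3_frame_pos conn Mx ijk i0 j0).
have neg i j k : uniq [:: i; j; k] -> x ord0 i < 0 -> x ord0 j < 0 ->
    exists I, simplicial_frame e x I.
  move=> ijk i0 j0; have Mx' := csa_complementN Mx.
  have [||I /simplicial_frameN] := complete3_frame_pos conn Mx' ijk; rewrite ?mxE ?oppr_gt0 //.
  by exists I.
move: (x0 a) (x0 b) (x0 c).
case: (ltgtP 0 (x ord0 a)) => [a0|a0|//].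
  case: (ltgtP 0 (x ord0 b)) => [b0|b0|//].
    by move=> *; apply: (pos a b c).
  case: (ltgtP 0 (x ord0 c)) => [c0|c0|//].
    by move=> *; apply: (pos a c b).
  by move=> *; apply: (neg b c a).
case: (ltgtP 0 (x ord0 b)) => [b0|b0|//].
  case: (ltgtP 0 (x ord0 c)) => [c0|c0|//].
    by move=> *; apply: (pos b c a).
  by move=> *; apply: (neg a c b).
by move=> *; apply: (neg a b c).
Qed.

(** * Bounding forms for a path *)

(** [g] gives the position of a vertex along the path. Half-open bounds make the form a difference
    of two prefix sums. *)
Definition label_interval (n : nat) (g : 'I_n -> 'I_n) (a b : nat) : {set 'I_n} :=
  [set v | (a <= g v < b)%N].

(** For [k] from 0 to [n] these are the [n + 1] braid coordinates, the first of them equal to 0. *)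
Definition prefix_sum (R : realType) (n : nat) (g : 'I_n -> 'I_n) (y : 'rV[R]_n) (k : nat) : R :=
  \sum_(v | (g v < k)%N) y ord0 v.

Lemma subset_sum_interval (R : realType) (n : nat) (g : 'I_n -> 'I_n) (y : 'rV[R]_n)
    (a b : nat) :
  (a <= b)%N -> subset_sum (label_interval g a b) y = prefix_sum g y b - prefix_sum g y a.
Proof.
move=> ab; rewrite /prefix_sum (bigID (fun v => g v < a)%N) /= addrC.
rewrite (eq_bigl (fun v => v \in label_interval g a b)); last first.
  by move=> v; rewrite inE -leqNgt andbC.
rewrite [X in _ + X - _](eq_bigl (fun v => g v < a)%N) ?addrK //.
by move=> v; case: (ltnP (g v) a) => [va|]; rewrite ?andbF // (leq_trans va ab).
Qed.

Lemma label_interval_connected (n : nat) (e : rel 'I_n) (f g : 'I_n -> 'I_n) (a b : nat) :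
  symmetric e -> cancel f g -> cancel g f ->
  (forall i j : 'I_n, e (f i) (f j) = ((i.+1 == j) || (j.+1 == i))%N) ->
  (a < b <= n)%N -> induced_connected e (label_interval g a b).
Proof.
move=> sym_e fK gK eE /andP[ab bn]; have an : (a < n)%N by apply: leq_trans bn.
pose r := f (Ordinal an).
have rI : r \in label_interval g a b by rewrite inE fK /= leqnn.
pose e' := [rel u v | [&& e u v, u \in label_interval g a b & v \in label_interval g a b]].
have sym_e' : symmetric e'.
  by move=> u v /=; rewrite sym_e [(v \in _) && _]andbC.
have conn m v : g v = m :> nat -> v \in label_interval g a b -> connect e' r v.
  elim: m v => [|m IH] v gv vI.
    move: vI; rewrite inE gv leqn0 => /andP[/eqP a0 _].
    suff -> : v = r by exact: connect0.
    by rewrite -[v]gK /r; congr f; apply/val_inj; rewrite /= gv a0.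
  have [ma|am] := eqVneq m.+1 a.
    suff -> : v = r by exact: connect0.
    by rewrite -[v]gK /r; congr f; apply/val_inj; rewrite /= gv ma.
  have mn : (m < n)%N by rewrite (ltn_trans (ltnSn m)) // -gv.
  have wI : f (Ordinal mn) \in label_interval g a b.
    by move: vI; rewrite !inE fK gv /=; lia.
  apply: connect_trans (IH (f (Ordinal mn)) _ wI) _; first by rewrite fK.
  by apply: connect1; rewrite /= wI vI -[v]gK eE gv eqxx.
split; first by apply/set0Pn; exists r.
move=> u v uI vI; apply: connect_trans (conn _ v erefl vI).
by rewrite (sym_connect_sym sym_e'); apply: conn erefl uI.
Qed.

(** The bounds come from the least and greatest labels in [J]. A label missing in between would
    disconnect [J], since an edge changes the label by exactly one. *)
Lemma connected_label_interval (n : nat) (e : rel 'I_n) (f g : 'I_n -> 'I_n) (J : {set 'I_n}) :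
  symmetric e -> cancel f g -> cancel g f ->
  (forall i j : 'I_n, e (f i) (f j) = ((i.+1 == j) || (j.+1 == i))%N) ->
  induced_connected e J ->
  exists a b, (a < b <= n)%N /\ J = label_interval g a b.
Proof.
move=> sym_e fK gK eE [/set0Pn[v0 v0J] conn].
case: (arg_minnP (fun v => nat_of_ord (g v)) v0J) => lo loJ lo_min.
case: (arg_maxnP (fun v => nat_of_ord (g v)) v0J) => hi hiJ hi_max.
exists (g lo), (g hi).+1; rewrite ltn_ord ltnS lo_min //; split=> //.
apply/setP => v; rewrite inE ltnS; apply/idP/idP => [vJ|/andP[lov vhi]].
  by rewrite lo_min //; apply: hi_max.
apply: contrapT => /negP vJ.
have neq w : w \in J -> g w != g v :> nat.
  by move=> wJ; apply: contraNneq vJ => /val_inj /(can_inj gK) <-.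
have clos : fingraph.closed [rel u v | [&& e u v, u \in J & v \in J]]
              [pred w | g w < g v]%N.
  apply: intro_closed => [|u w /=].
    by apply: sym_connect_sym => u w /=; rewrite sym_e [(w \in _) && _]andbC.
  rewrite !inE => /and3P[]; rewrite -{1}[u]gK -{1}[w]gK eE => uw uJ wJ.
  by have := neq _ wJ; lia.
have := closed_connect clos (conn _ _ loJ hiJ); rewrite !inE.
by have := neq _ loJ; lia.
Qed.

Lemma path_frame (R : realType) (n : nat) (e : rel 'I_n) (x : 'rV[R]_n) :
  symmetric e -> is_path_graph e -> csa_complement e x ->
  exists I, simplicial_frame e x I.
Proof.
move=> sym_e [f [[g fK gK] eE]] /csa_complementE Mx.
have Jconn a b : (a < b <= n)%N -> induced_connected e (label_interval g a b).
  exact: label_interval_connected sym_e fK gK eE.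
(* Consecutive sorted prefix sums may carry labels in either order, so the set ignores the order;
   the resulting sign squares away in [Jsign]. *)
pose J a b := label_interval g (minn a b) (maxn a b).
have JP a b : (a <= n)%N -> (b <= n)%N -> a != b -> induced_connected e (J a b).
  by move=> an bn ab; apply: Jconn; lia.
have Jsum a b (y : 'rV[R]_n) : subset_sum (J a b) y =
    (-1) ^+ (b < a)%N * (prefix_sum g y b - prefix_sum g y a).
  rewrite /J; case: (ltnP b a) => ab; rewrite subset_sum_interval ?(ltnW ab) //.
    by rewrite expr1 mulN1r opprB.
  by rewrite mul1r.
have Jsign a b (y : 'rV[R]_n) : subset_sum (J a b) y * subset_sum (J a b) x =
    (prefix_sum g y b - prefix_sum g y a) * (prefix_sum g x b - prefix_sum g x a).
  by rewrite !Jsum mulrACA -expr2 sqrr_sign mul1r.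
have Sneq a b : (a <= n)%N -> (b <= n)%N -> a != b -> prefix_sum g x b - prefix_sum g x a != 0.
  by move=> an bn ab; have := Mx _ (JP _ _ an bn ab); rewrite Jsum mulf_eq0 signr_eq0.
(* [s] lists the labels 0 to [n] by increasing prefix sum at [x]; below, [w k] is the label of rank
   [k]. *)
pose s := sort (fun a b => prefix_sum g x a <= prefix_sum g x b) (iota 0 n.+1).
have szs : size s = n.+1 by rewrite size_sort size_iota.
have us : uniq s by rewrite sort_uniq iota_uniq.
have mems a : (a \in s) = (a <= n)%N by rewrite mem_sort mem_iota.
pose w k := nth 0%N s k.
have wn k : (k <= n)%N -> (w k <= n)%N by move=> kn; rewrite -mems mem_nth // szs.
have wneq k l : (k <= n)%N -> (l <= n)%N -> k != l -> w k != w l.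
  by move=> kn ln kl; rewrite /w nth_uniq // szs.
have wsurj a : (a <= n)%N -> exists2 k, (k <= n)%N & a = w k.
  move=> an; exists (index a s); last by rewrite /w nth_index // mems.
  by rewrite -ltnS -szs index_mem mems.
have xinc k : (k < n)%N -> 0 < prefix_sum g x (w k.+1) - prefix_sum g x (w k).
  move=> kn; rewrite lt_neqAle eq_sym Sneq ?wn ?wneq //=; try lia.
  rewrite subr_ge0; have ss : sorted (fun a b => prefix_sum g x a <= prefix_sum g x b) s.
    by apply: sort_sorted => a b; apply: le_total.
  by move/(sortedP 0%N): ss; apply; rewrite szs.
(* Every difference of prefix sums telescopes into consecutive gaps, so positive gaps decide all
   signs. *)
have yinc (y : 'rV[R]_n) :
    (forall k, (k < n)%N -> 0 < prefix_sum g y (w k.+1) - prefix_sum g y (w k)) ->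
    forall k l, (k < l)%N -> (l <= n)%N -> 0 < prefix_sum g y (w l) - prefix_sum g y (w k).
  move=> inc k; elim=> // l IH; rewrite ltnS leq_eqVlt => /orP[/eqP->|kl] ln; first exact: inc.
  by have := inc _ ln; have := IH kl (ltnW ln); lra.
exists (fun k => J (w k) (w k.+1)); split=> [k|y y0|y y0].
- by apply: JP; rewrite ?wn ?wneq //; have := ltn_ord k; lia.
(* If all gaps vanish then all prefix sums agree, and each coordinate is a difference of two of
   them. *)
- have Sconst k : (k <= n)%N -> prefix_sum g y (w k) = prefix_sum g y (w 0%N).
    elim: k => // k IH kn; have /eqP := y0 (Ordinal kn).
    by rewrite Jsum mulf_eq0 signr_eq0 /= subr_eq0 => /eqP ->; apply: IH; apply: ltnW.
  have S0 a b : (a <= n)%N -> (b <= n)%N -> prefix_sum g y a = prefix_sum g y b.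
    by move=> /wsurj[k kn ->] /wsurj[l ln ->]; rewrite !Sconst.
  apply/rowP => v; rewrite mxE.
  have := subset_sum_interval g y (leqnSn (g v)).
  rewrite (S0 (g v).+1 (g v)) ?subrr; try (by have := ltn_ord (g v); lia).
  move=> <-; rewrite /subset_sum (big_pred1 v) // => u; rewrite inE ltnS -eqn_leq eq_sym.
  by rewrite val_eqE (inj_eq (can_inj gK)).
- have xinc_lt := yinc x xinc.
  have {}yinc : forall k l, (k < l)%N -> (l <= n)%N ->
      0 < prefix_sum g y (w l) - prefix_sum g y (w k).
    apply: yinc => k kn; have := y0 (Ordinal kn).
    by rewrite Jsign mulrC pmulr_rgt0 //; apply: xinc.
  move=> K /(connected_label_interval sym_e fK gK eE)[a [b [/andP[ab bn] ->]]].
  rewrite !subset_sum_interval ?(ltnW ab) //.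
  have [k kn ak] := wsurj a (leq_trans (ltnW ab) bn); have [l ln bl] := wsurj b bn.
  (* [a < b] does not order the ranks; when they are reversed, both factors change sign. *)
  move: ab; rewrite ak bl => ab; case: (ltngtP k l) => [kl|lk|kl].
  + by rewrite mulr_gt0 // ?yinc ?xinc_lt.
  + by rewrite -mulrNN !opprB mulr_gt0 // ?yinc ?xinc_lt.
  + by rewrite kl ltnn in ab.
Qed.

Theorem theorem7p2 (R : realType) (n : nat) (e : rel 'I_n) :
  simple_graph e -> graph_connected e ->
  (simplicial_complement (@csa_complement R n e) <-> (is_triangle e \/ is_path_graph e)).
Proof.
move=> simple_e conn_e; have [sym_e _] := simple_e; split=> [simpl|tri_or_path x Mx].
  have [|| [a [b [c [K ob]]]]] := path_triangle_or_obstruction simple_e conn_e.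
  - by left.
  - by right.
  - by have := obstruction_not_simplicial sym_e ob simpl.
rewrite connected_component_csa //.
suff [I frame] : exists I, simplicial_frame e x I by apply: simplicial_frame_cone frame.
case: tri_or_path => [[n3 eE]|path_e]; last exact: path_frame path_e Mx.
by subst n; apply: triangle_frame.
Qed.
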